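(* Let $\mathbf F:\mathbb R^d\to\mathbb R^d$ be differentiable with Jacobian $\mathbf J$, and let $L_1,L_2\ge 0$ and $M>0$ be constants such that for all $\mathbf x,\mathbf y\in\mathbb R^d$: (i) $\|\mathbf J(\mathbf x)\|\le L_1$ and $\|\mathbf J(\mathbf x)-\mathbf J(\mathbf y)\|\le L_2\|\mathbf x-\mathbf y\|$; (ii) $\|\mathbf F(\mathbf y)\|^2\le\|\mathbf F(\mathbf x)+\mathbf J(\mathbf x)(\mathbf y-\mathbf x)\|^2+M\|\mathbf y-\mathbf x\|^3$. Let $\mathbf x_0\in\mathbb R^d$. Then the GRLM method started at $\mathbf x_0$ with period $m=\Theta(\epsilon^{-1})$ and regularization constant $c=\max\{4L_1L_2m,\,M\}$ finds an $\epsilon$-stationary point of $\phi(\mathbf x)=\frac12\|\mathbf F(\mathbf x)\|^2$ within $\mathcal O(d^3\epsilon^{-1}+d^2\epsilon^{-2})$ flops. Explicitly: for all constants $0<c_1\le c_2$ there is a constant $C>0$ depending only on $c_1,c_2,L_1,L_2,M,\|\mathbf F(\mathbf x_0)\|$ and the constant $C_0$ of the cost model (not on $d$, $m$ or $\epsilon$) such that for every $\epsilon>0$ and every integer $m\ge1$ with $c_1\epsilon^{-1}\le m\le c_2\epsilon^{-1}$, there is an integer $T\ge 1$ such that $\min_{0\le t\le T-1}\|\mathbf J(\mathbf x_t)^\top\mathbf F(\mathbf x_t)\|\le\epsilon$ and the total cost of the first $T$ iterations is at most $C\,(d^3\epsilon^{-1}+d^2\epsilon^{-2})$ flops.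
   Context: $\|\cdot\|$ is the Euclidean norm of vectors and the spectral norm of matrices. $\mathbf J(\mathbf x)\in\mathbb R^{d\times d}$ is the Jacobian of $\mathbf F$ at $\mathbf x$, and $\mathbf I$ is the identity matrix. A point $\mathbf x$ is an $\epsilon$-stationary point of $\phi=\frac12\|\mathbf F(\cdot)\|^2$ if $\|\mathbf J(\mathbf x)^\top\mathbf F(\mathbf x)\|\le\epsilon$. GRLM (Gram-Reduced Levenberg--Marquardt) method with integer period $m\ge1$, constant $c>0$ and starting point $\mathbf x_0$: for $t=0,1,2,\dots$ put $\pi(t)=m\lfloor t/m\rfloor$, $\mathbf z_t=\mathbf x_{\pi(t)}$, $\lambda_t=\sqrt{c\,\|\mathbf J(\mathbf x_t)^\top\mathbf F(\mathbf x_t)\|}$, and $$\mathbf x_{t+1}=\mathbf x_t-\big(\mathbf J(\mathbf z_t)^\top\mathbf J(\mathbf z_t)+\lambda_t\mathbf I\big)^{-1}\mathbf J(\mathbf x_t)^\top\mathbf F(\mathbf x_t).$$ If $\mathbf J(\mathbf x_t)^\top\mathbf F(\mathbf x_t)=\mathbf 0$, the step is understood to be zero, i.e. $\mathbf x_{t+1}=\mathbf x_t$. Cost model: at each snapshot iteration $t\equiv0\pmod m$ a singular value decomposition $\mathbf J(\mathbf z_t)=\mathbf U\boldsymbol\Sigma\mathbf V^\top$ is computed, at a cost of at most $C_0d^3$ flops; it is reused during the next $m$ iterations, so that the update $\mathbf x_{t+1}=\mathbf x_t-\mathbf V(\boldsymbol\Sigma^2+\lambda_t\mathbf I)^{-1}\mathbf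 V^\top\mathbf J(\mathbf x_t)^\top\mathbf F(\mathbf x_t)$ (including forming $\mathbf J(\mathbf x_t)^\top\mathbf F(\mathbf x_t)$) costs at most $C_0d^2$ flops in every iteration. Hence the cost of the first $T$ iterations is at most $C_0(d^3\lceil T/m\rceil+d^2T)$ flops, and this quantity is taken as the total cost. Here $C_0>0$ is an absolute constant. *)

(* Defs.v *)
From HB Require Import structures.
From mathcomp Require Import all_boot all_order all_algebra.
From mathcomp Require Import all_classical all_reals all_analysis.

Set Implicit Arguments.
Unset Strict Implicit.
Unset Printing Implicit Defensive.

Import Order.TTheory GRing.Theory Num.Theory.
Import numFieldNormedType.Exports.

Local Open Scope classical_set_scope.
Local Open Scope ring_scope.

(* Points of R^d are column vectors, so that matrices act on the left. *)

(* The library norm `|v| on matrices is the sup norm; it is used here only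
   through the topology (in `differentiable`), never in the estimates. *)
Definition enorm (R : realType) (d : nat) (v : 'cV[R]_d) : R :=
  Num.sqrt (\sum_(i < d) v i 0 ^+ 2).

(* Operator norm induced by enorm, i.e. the spectral norm. *)
Definition snorm (R : realType) (d : nat) (A : 'M[R]_d) : R :=
  sup [set enorm (A *m v) | v in [set v : 'cV[R]_d | enorm v <= 1]].

(* Entry (i, j) is the partial derivative of F_i in direction e_j; this is the
   transpose of the convention of the library's `jacobian`, which acts on row
   vectors from the right. *)
Definition Jac (R : realType) (d : nat) (F : 'cV[R]_d -> 'cV[R]_d)
    (x : 'cV[R]_d) : 'M[R]_d :=
  \matrix_(i < d, j < d) ('D_(delta_mx j 0) F x) i 0.

(* Gradient of phi = 1/2 ||F||^2. *)
Definition gradphi (R : realType) (d : nat) (F : 'cV[R]_d -> 'cV[R]_d)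
    (x : 'cV[R]_d) : 'cV[R]_d :=
  (Jac F x)^T *m F x.

Definition snapshot (m t : nat) : nat := (m * (t %/ m))%N.

Definition reg (R : realType) (d : nat) (F : 'cV[R]_d -> 'cV[R]_d) (c : R)
    (x : 'cV[R]_d) : R :=
  Num.sqrt (c * enorm (gradphi F x)).

Definition GRLM_step (R : realType) (d : nat) (F : 'cV[R]_d -> 'cV[R]_d)
    (c : R) (z x : 'cV[R]_d) : 'cV[R]_d :=
  if gradphi F x == 0 then x
  else x - invmx ((Jac F z)^T *m Jac F z + (reg F c x)%:M) *m gradphi F x.

(* x is the (unique) sequence of iterates of the method. *)
Definition GRLM (R : realType) (d : nat) (F : 'cV[R]_d -> 'cV[R]_d)
    (m : nat) (c : R) (x0 : 'cV[R]_d) (x : nat -> 'cV[R]_d) : Prop :=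
  x 0%N = x0 /\
  forall t : nat, x t.+1 = GRLM_step F c (x (snapshot m t)) (x t).

(* One SVD (C0 d^3) per snapshot and C0 d^2 per iteration, over the first T
   iterations. *)
Definition flops (R : realType) (C0 : R) (d m T : nat) : R :=
  C0 * (d%:R ^+ 3 * (Num.ceil (T%:R / m%:R : R))%:~R + d%:R ^+ 2 * T%:R).

(* Main.v *)
Require Import Defs.
From mathcomp Require Import all_boot all_order all_algebra.
From mathcomp Require Import all_classical all_reals all_analysis.
From mathcomp Require Import ring lra.

Import Order.TTheory GRing.Theory Num.Theory.
Import numFieldNormedType.Exports.

Local Open Scope classical_set_scope.
Local Open Scope ring_scope.

(** Write g, s, lam for the gradient, step and regularization of an iteration
    at x with snapshot z, and let B be the Jacobian at z and
    D = |B s|^2 + lam |s|^2 the energy of the step.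

    The step satisfies (B^T B + lam I) s = - g.  If B were the current Jacobian
    then the Gauss-Newton model |F + J s|^2 would drop by at least
    D + lam |s|^2.  Two errors are to be absorbed.  The cubic remainder
    M |s|^3 is at most lam |s|^2, because lam |s| <= |g| = lam^2 / c gives
    c |s| <= lam and M <= c.  The staleness of B adds at most
    2 L1 L2 |x - z| |s|^2 ([model_decrease], [GRLM_step_decrease]).

    The staleness error need not be small at a single step, but it is over a
    whole period of m steps.  The drift |x - z| is at most the sum of the
    earlier step lengths r_i in the period, and
    sum_j r_j^2 (sum_(i < j) r_i) <= m sum_j r_j^3 ([sum_sqr_prefix_le]);
    since c r_j^3 <= D_j and c >= 4 L1 L2 m, the errors of the period eat at
    most half of the total energy ([epoch_decrease]).

    The energy controls the gradient: |g|^2 <= (L1^2 + lam) D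
    ([grad_sqr_le_energy]).  So as long as |g| > eps, each iteration lowers
    |F|^2 on average over a period by at least
    eps^2 / (2 (L1^2 + sqrt (c eps))) ([GRLM_epochs_decrease]).  As m is of
    order 1 / eps and m >= 1, both eps and m eps are bounded by c2, so c eps is
    bounded by a constant K and this decrease is of order eps^2.  Since |F|^2
    cannot become negative, O(1 / eps) periods suffice; each costs one
    decomposition and O(1 / eps) cheap iterations, which gives the flop
    count. *)

(** * Euclidean norm and spectral norm *)

Definition dot {R : realType} {d : nat} (u v : 'cV[R]_d) : R :=
  (u^T *m v) 0 0.

Section EuclideanGeometry.
Context {R : realType} {d : nat}.
Implicit Types (u v w : 'cV[R]_d) (A : 'M[R]_d).

Lemma dotE u v : dot u v = \sum_i u i 0 * v i 0.
Proof. by rewrite /dot mxE; apply: eq_bigr => i _; rewrite mxE. Qed.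

Lemma dotC u v : dot u v = dot v u.
Proof. by rewrite !dotE; apply: eq_bigr => i _; rewrite mulrC. Qed.

Lemma dotDr u v w : dot u (v + w) = dot u v + dot u w.
Proof. by rewrite /dot mulmxDr mxE. Qed.

Lemma dotDl u v w : dot (u + v) w = dot u w + dot v w.
Proof. by rewrite dotC dotDr !(dotC w). Qed.

Lemma dotZr a u v : dot u (a *: v) = a * dot u v.
Proof. by rewrite /dot -scalemxAr mxE. Qed.

Lemma dotZl a u v : dot (a *: u) v = a * dot u v.
Proof. by rewrite dotC dotZr dotC. Qed.

Lemma dotNr u v : dot u (- v) = - dot u v.
Proof. by rewrite -scaleN1r dotZr mulN1r. Qed.

Lemma dotNl u v : dot (- u) v = - dot u v.
Proof. by rewrite dotC dotNr dotC. Qed.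

Lemma dot_trmxl A u v : dot (A^T *m u) v = dot u (A *m v).
Proof. by rewrite /dot trmx_mul trmxK mulmxA. Qed.

Lemma dot_ge0 v : 0 <= dot v v.
Proof. by rewrite dotE sumr_ge0 // => i _; rewrite -expr2 sqr_ge0. Qed.

Lemma dot_eq0 v : dot v v = 0 -> v = 0.
Proof.
rewrite dotE => /eqP; rewrite psumr_eq0 => [|i _]; last by rewrite -expr2 sqr_ge0.
move=> /allP v0; apply/colP => i; rewrite mxE.
by have := v0 i (mem_index_enum i); rewrite /= mulf_eq0 orbb => /eqP.
Qed.

Lemma enorm_ge0 v : 0 <= enorm v.
Proof. exact: sqrtr_ge0. Qed.

Lemma enorm_sqr v : enorm v ^+ 2 = dot v v.
Proof.
rewrite dotE /enorm sqr_sqrtr; last by apply: sumr_ge0 => i _; exact: sqr_ge0.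
by apply: eq_bigr => i _; rewrite expr2.
Qed.

Lemma enorm_eq0 v : enorm v = 0 -> v = 0.
Proof. by move=> v0; apply: dot_eq0; rewrite -enorm_sqr v0 expr0n. Qed.

Lemma enorm_le v a : 0 <= a -> dot v v <= a ^+ 2 -> enorm v <= a.
Proof. by move=> a0; rewrite -enorm_sqr ler_sqr // nnegrE // enorm_ge0. Qed.

(** The Cauchy-Schwarz inequality, squared. *)
Lemma dot_sqr_le u v : dot u v ^+ 2 <= dot u u * dot v v.
Proof.
have [u0|u0] := eqVneq (dot u u) 0.
  by rewrite (dot_eq0 _ u0) -(scale0r v) !dotZl !mul0r expr0n.
have up : 0 < dot u u by rewrite lt_def u0 dot_ge0.
(* the component of |u|^2 v orthogonal to u has a nonnegative square *)
have := dot_ge0 (dot u u *: v - dot u v *: u).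
rewrite !(dotDl, dotDr, dotNl, dotNr, dotZl, dotZr) (dotC v u) => h.
rewrite -subr_ge0 -(pmulr_rge0 _ up).
by apply: le_trans h _; rewrite le_eqVlt; apply/orP; left; apply/eqP; ring.
Qed.

Lemma dot_le u v : dot u v <= enorm u * enorm v.
Proof.
apply: le_trans (ler_norm _) _.
rewrite -ler_sqr ?nnegrE ?normr_ge0 ?mulr_ge0 ?enorm_ge0 //.
by rewrite real_normK ?num_real // exprMn !enorm_sqr dot_sqr_le.
Qed.

Lemma enormZ a v : enorm (a *: v) = `|a| * enorm v.
Proof.
apply/eqP; rewrite -(@eqrXn2 _ 2) // ?mulr_ge0 ?enorm_ge0 //.
by rewrite exprMn real_normK ?num_real // !enorm_sqr dotZl dotZr mulrA -expr2.
Qed.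

Lemma enorm0 : enorm (0 : 'cV[R]_d) = 0.
Proof. by rewrite -(scale0r 0) enormZ normr0 mul0r. Qed.

Lemma enormD u v : enorm (u + v) <= enorm u + enorm v.
Proof.
apply: enorm_le; first by rewrite addr_ge0 ?enorm_ge0.
rewrite !(dotDl, dotDr) (dotC v u) sqrrD !enorm_sqr.
by have := dot_le u v; lra.
Qed.

(** The Frobenius norm is a bound, by Cauchy-Schwarz on every row. *)
Lemma mulmx_enorm_bounded A : exists K, forall v, enorm (A *m v) <= K * enorm v.
Proof.
pose S := \sum_i dot (row i A)^T (row i A)^T.
have S0 : 0 <= S by apply: sumr_ge0 => i _; exact: dot_ge0.
exists (Num.sqrt S) => v.
apply: enorm_le; first by rewrite mulr_ge0 ?sqrtr_ge0 ?enorm_ge0.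
rewrite exprMn sqr_sqrtr // enorm_sqr dotE mulr_suml; apply: ler_sum => i _.
suff -> : (A *m v) i 0 = dot (row i A)^T v by rewrite -expr2 dot_sqr_le.
by rewrite /dot trmxK -row_mul [RHS]mxE.
Qed.

(** The supremum that defines the spectral norm is over a bounded set, since
    the dimension is finite; so it really dominates every unit vector. *)
Lemma mulmx_enorm_le A L v : snorm A <= L -> enorm (A *m v) <= L * enorm v.
Proof.
move=> AL; have [K hK] := mulmx_enorm_bounded A.
have [v0|v0] := eqVneq (enorm v) 0.
  by apply: le_trans (hK v) _; rewrite v0 !mulr0.
have vp : 0 < enorm v by rewrite lt_def v0 enorm_ge0.
have unit_v : enorm ((enorm v)^-1 *: v) = 1.
  by rewrite enormZ ger0_norm ?invr_ge0 ?enorm_ge0 // mulVf.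
have : enorm (A *m ((enorm v)^-1 *: v)) <= snorm A.
  apply: ub_le_sup; last by exists ((enorm v)^-1 *: v) => //=; rewrite unit_v.
  exists `|K| => _ [w w1 <-]; apply: le_trans (hK w) _.
  apply: le_trans (ler_norm _) _; rewrite normrM (ger0_norm (enorm_ge0 w)).
  by rewrite ler_piMr.
move/le_trans/(_ AL).
rewrite -scalemxAr enormZ ger0_norm ?invr_ge0 ?enorm_ge0 // mulrC.
by rewrite ler_pdivrMr.
Qed.

(** |A^T v|^2 = <v, A A^T v> <= |v| L |A^T v|. *)
Lemma trmx_enorm_le A L : (forall v, enorm (A *m v) <= L * enorm v) ->
  forall v, enorm (A^T *m v) <= L * enorm v.
Proof.
move=> AL v; have [->|w0] := eqVneq (enorm (A^T *m v)) 0.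
  exact: le_trans (enorm_ge0 _) (AL v).
have wp : 0 < enorm (A^T *m v) by rewrite lt_def w0 enorm_ge0.
rewrite -(ler_pM2r wp) -expr2 enorm_sqr dot_trmxl.
apply: le_trans (dot_le _ _) _.
by rewrite mulrAC mulrC ler_wpM2r ?enorm_ge0 // AL.
Qed.

End EuclideanGeometry.

(** * One regularized step with a stale Jacobian *)

(** The quadratic form <s, (B^T B + lam I) s>. *)
Definition energy {R : realType} {d : nat}
    (B : 'M[R]_d) (lam : R) (s : 'cV[R]_d) : R :=
  enorm (B *m s) ^+ 2 + lam * enorm s ^+ 2.

Section DampedStep.
Context {R : realType} {d : nat}.
Variables (B : 'M[R]_d) (g s : 'cV[R]_d) (lam : R).
Hypothesis lam0 : 0 < lam.

Lemma damped_gram_unit : B^T *m B + lam%:M \in unitmx.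
Proof.
rewrite -unitmx_tr -row_free_unit; apply: inj_row_free => v v0.
apply: trmx_inj; rewrite trmx0; set u := v^T.
have Hu : (B^T *m B + lam%:M) *m u = 0.
  by rewrite -[B^T *m B + _]trmxK -trmx_mul v0 trmx0.
have : energy B lam u = 0.
  have <- : dot u ((B^T *m B + lam%:M) *m u) = energy B lam u.
    by rewrite mulmxDl mul_scalar_mx -mulmxA dotDr dotZr -dot_trmxl trmxK
               /energy !enorm_sqr.
  by rewrite Hu -(scale0r u) dotZr mul0r.
have := sqr_ge0 (enorm (B *m u)); have := sqr_ge0 (enorm u).
rewrite /energy => h2 h1 h3; apply: enorm_eq0.
have h4 := mulr_ge0 (ltW lam0) h2.
have : lam * enorm u ^+ 2 = 0 by lra.
by move=> /eqP; rewrite mulf_eq0 gt_eqF //= expf_eq0 /= => /eqP.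
Qed.

Hypothesis hs : (B^T *m B + lam%:M) *m s = - g.

Lemma damped_gradE : g = - (B^T *m (B *m s) + lam *: s).
Proof. by rewrite -[g]opprK -hs mulmxDl mul_scalar_mx mulmxA. Qed.

Lemma dot_damped_grad : dot g s = - energy B lam s.
Proof.
by rewrite damped_gradE dotNl dotDl dotZl dot_trmxl /energy !enorm_sqr.
Qed.

(** From lam |s|^2 <= energy = - <g, s> <= |g| |s|. *)
Lemma damped_step_le : lam * enorm s <= enorm g.
Proof.
have [->|s0] := eqVneq (enorm s) 0; first by rewrite mulr0 enorm_ge0.
have sp : 0 < enorm s by rewrite lt_def s0 enorm_ge0.
rewrite -(ler_pM2r sp).
have := dot_le (- g) s; rewrite dotNl dot_damped_grad opprK.
have -> : enorm (- g) = enorm g by rewrite -scaleN1r enormZ normrN1 mul1r.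
apply: le_trans; rewrite /energy; have := sqr_ge0 (enorm (B *m s)); lra.
Qed.

(** The damping turns the first-order optimality of the step into a lower
    bound on its energy: writing p = |B s|, r = |s|, one has
    |g| <= L p + lam r, and (L^2 + lam) (p^2 + lam r^2) - (L p + lam r)^2
    is the square lam (L r - p)^2. *)
Lemma grad_sqr_le_energy L : (forall v, enorm (B *m v) <= L * enorm v) ->
  enorm g ^+ 2 <= (L ^+ 2 + lam) * energy B lam s.
Proof.
move=> BL.
have h : enorm g <= L * enorm (B *m s) + lam * enorm s.
  rewrite damped_gradE -scaleN1r enormZ normrN1 mul1r.
  apply: le_trans (enormD _ _) _; rewrite enormZ (gtr0_norm lam0).
  by rewrite lerD2r trmx_enorm_le.
apply: (@le_trans _ _ ((L * enorm (B *m s) + lam * enorm s) ^+ 2)).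
  by rewrite ler_sqr // nnegrE ?enorm_ge0 // (le_trans (enorm_ge0 g)).
rewrite /energy -subr_ge0.
have -> : forall p r, (L ^+ 2 + lam) * (p ^+ 2 + lam * r ^+ 2)
    - (L * p + lam * r) ^+ 2 = lam * (L * r - p) ^+ 2 by move=> p r; ring.
by rewrite mulr_ge0 ?sqr_ge0 // ltW.
Qed.

(** Replacing the current Jacobian [A] by the stale [B] costs
    |A s|^2 - |B s|^2 = <(A - B) s, (A + B) s>, which is second order in [s]
    and proportional to the staleness. *)
Lemma model_decrease A f L e : g = A^T *m f -> 0 <= L -> 0 <= e ->
  (forall v, enorm (A *m v) <= L * enorm v) ->
  (forall v, enorm (B *m v) <= L * enorm v) ->
  (forall v, enorm ((A - B) *m v) <= e * enorm v) ->
  enorm (f + A *m s) ^+ 2 <=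
    enorm f ^+ 2 - energy B lam s - lam * enorm s ^+ 2
    + 2 * L * e * enorm s ^+ 2.
Proof.
move=> gE L0 e0 AL BL ABe.
have fAs : dot f (A *m s) = - energy B lam s.
  by rewrite -dot_trmxl -gE dot_damped_grad.
have swap : enorm (A *m s) ^+ 2 - enorm (B *m s) ^+ 2
    = dot ((A - B) *m s) (A *m s + B *m s).
  rewrite mulmxBl !enorm_sqr !(dotDl, dotDr, dotNl) (dotC (B *m s) (A *m s)).
  ring.
have : dot ((A - B) *m s) (A *m s + B *m s)
    <= (e * enorm s) * (2 * L * enorm s).
  apply: le_trans (dot_le _ _) _; apply: ler_pM; rewrite ?enorm_ge0 ?ABe //.
  by apply: le_trans (enormD _ _) _; have := AL s; have := BL s; lra.
rewrite -swap (enorm_sqr (f + _)) !(dotDl, dotDr) (dotC (A *m s) f) fAs.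
rewrite -!enorm_sqr.
by rewrite /energy => h; lra.
Qed.

End DampedStep.

(** * Summation over a period *)

(** By r_j^2 r_i <= r_j^3 + r_i^3: an index k occurs k times as j and
    n - 1 - k times as i. *)
Lemma sum_sqr_prefix_le {R : realType} (n : nat) (r : nat -> R) :
  (forall j, 0 <= r j) ->
  \sum_(j < n) r j ^+ 2 * (\sum_(i < j) r i) <= n%:R * \sum_(j < n) r j ^+ 3.
Proof.
move=> r0; elim: n => [|n IH]; first by rewrite !big_ord0 mulr0.
rewrite !big_ord_recr /=.
have : r n ^+ 2 * (\sum_(i < n) r i) <= n%:R * r n ^+ 3 + \sum_(i < n) r i ^+ 3.
  have -> : n%:R * r n ^+ 3 = \sum_(i < n) r n ^+ 3.
    by rewrite sumr_const card_ord mulr_natl.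
  rewrite mulr_sumr -big_split /=; apply: ler_sum => i _.
  have := r0 n; have := r0 i; set u := r n; set v := r i => v0 u0.
  have [uv|/ltW vu] := leP u v.
    have : u ^+ 2 * v <= v ^+ 3.
      by rewrite [leRHS]exprSr ler_wpM2r // ler_sqr.
    by have := exprn_ge0 3 u0; lra.
  have : u ^+ 2 * v <= u ^+ 3 by rewrite [leRHS]exprSr ler_wpM2l // sqr_ge0.
  by have := exprn_ge0 3 v0; lra.
have := exprn_ge0 3 (r0 n); rewrite -natr1; lra.
Qed.

(** Here [a] stands for |F|^2, [D] for the energies and [r] for the step lengths
    of the iterations of one period.  A step may increase [a]; only the sum
    over the period, where [sum_sqr_prefix_le] bounds the staleness errors by
    half of the energies, has a sign. *)
Lemma epoch_decrease {R : realType} (m : nat) (kappa c delta : R)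
    (a D r : nat -> R) :
  0 <= kappa -> 4 * kappa * m%:R <= c -> (forall j, 0 <= r j) ->
  (forall j, (j < m)%N ->
     [/\ a j.+1 <= a j - D j + 2 * kappa * (\sum_(i < j) r i) * r j ^+ 2,
         c * r j ^+ 3 <= D j & delta <= D j]) ->
  a m <= a 0%N - m%:R * delta / 2.
Proof.
move=> k0 kc r0 step.
have telescope n : (n <= m)%N -> a n <= a 0%N - \sum_(j < n) D j
    + 2 * kappa * \sum_(j < n) r j ^+ 2 * (\sum_(i < j) r i).
  elim: n => [|n IH] nm; first by rewrite !big_ord0; lra.
  have [h _ _] := step n nm; have := IH (ltnW nm).
  by rewrite !big_ord_recr /=; lra.
have Dr : c * \sum_(j < m) r j ^+ 3 <= \sum_(j < m) D j.
  by rewrite mulr_sumr; apply: ler_sum => j _; have [] := step j (ltn_ord j).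
have Dd : m%:R * delta <= \sum_(j < m) D j.
  have -> : m%:R * delta = \sum_(j < m) delta.
    by rewrite sumr_const card_ord mulr_natl.
  by apply: ler_sum => j _; have [] := step j (ltn_ord j).
have S0 : 0 <= \sum_(j < m) r j ^+ 3.
  by apply: sumr_ge0 => j _; rewrite exprn_ge0.
have h1 := ler_wpM2l k0 (sum_sqr_prefix_le m r r0).
have h2 := ler_wpM2r S0 kc.
have := telescope m (leqnn m); lra.
Qed.

(** The guaranteed energy at gradient norm [u] is increasing in [u], so a
    lower bound on the gradient gives one on the energy although the
    regularization grows with the gradient. *)
Lemma sqr_div_add_sqrt_le {R : realType} (L c u v : R) :
  0 < c -> 0 < u -> u <= v ->
  u ^+ 2 / (L ^+ 2 + Num.sqrt (c * u)) <= v ^+ 2 / (L ^+ 2 + Num.sqrt (c * v)).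
Proof.
move=> c0 u0 uv; have v0 := lt_le_trans u0 uv.
have den w : 0 < w -> 0 < L ^+ 2 + Num.sqrt (c * w).
  by move=> w0; rewrite ltr_wpDl ?sqr_ge0 // sqrtr_gt0 mulr_gt0.
rewrite ler_pdivrMr ?den // mulrAC ler_pdivlMr ?den //.
rewrite !sqrtrM ?(ltW c0) //.
(* in a = sqrt u and b = sqrt v the inequality is polynomial *)
have {1}-> : u = Num.sqrt u ^+ 2 by rewrite sqr_sqrtr ?ltW.
have {2}-> : v = Num.sqrt v ^+ 2 by rewrite sqr_sqrtr ?ltW.
have : Num.sqrt u <= Num.sqrt v by rewrite ler_wsqrtr.
have := sqrtr_ge0 u; have := sqrtr_ge0 c.
set a := Num.sqrt u; set b := Num.sqrt v; set q := Num.sqrt c => q0 a0 ab.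
have b0 := le_trans a0 ab.
have h4 : L ^+ 2 * a ^+ 4 <= L ^+ 2 * b ^+ 4.
  by rewrite ler_wpM2l ?sqr_ge0 // lerXn2r.
have h3 : q * (a * b) * a ^+ 3 <= q * (a * b) * b ^+ 3.
  by rewrite ler_wpM2l ?mulr_ge0 // lerXn2r.
lra.
Qed.

(** * Descent of the method *)

Lemma snapshot_epoch (m k j : nat) :
  (j < m)%N -> snapshot m (m * k + j) = (m * k)%N.
Proof.
move=> jm; have m0 := leq_ltn_trans (leq0n j) jm.
by rewrite /snapshot (mulnC m k) divnMDl // divn_small // addn0 mulnC.
Qed.

Section Method.
Context {R : realType} {d : nat}.
Variables (F : 'cV[R]_d -> 'cV[R]_d) (L1 L2 M c : R).
Hypotheses (L1_ge0 : 0 <= L1) (L2_ge0 : 0 <= L2) (c_gt0 : 0 < c) (Mc : M <= c).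
Hypothesis Jac_le : forall x, snorm (Jac F x) <= L1.
Hypothesis Jac_lip :
  forall x y, snorm (Jac F x - Jac F y) <= L2 * enorm (x - y).
Hypothesis residual_le : forall x y, enorm (F y) ^+ 2 <=
  enorm (F x + Jac F x *m (y - x)) ^+ 2 + M * enorm (y - x) ^+ 3.

(** The first bound is the Gauss-Newton decrease, where the term lam |s|^2 in
    excess of the energy has paid for the cubic remainder. *)
Lemma GRLM_step_decrease (z x : 'cV[R]_d) (s := GRLM_step F c z x - x)
    (D := energy (Jac F z) (reg F c x) s) : gradphi F x != 0 ->
  [/\ enorm (F (GRLM_step F c z x)) ^+ 2 <=
        enorm (F x) ^+ 2 - D + 2 * (L1 * L2) * enorm (x - z) * enorm s ^+ 2,
      c * enorm s ^+ 3 <= D &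
      enorm (gradphi F x) ^+ 2 <= (L1 ^+ 2 + reg F c x) * D].
Proof.
move=> g0; set lam := reg F c x in D *; set B := Jac F z in D *.
have gp : 0 < enorm (gradphi F x).
  by rewrite lt_def enorm_ge0 andbT; apply: contraNN g0 => /eqP /enorm_eq0 ->.
have lam0 : 0 < lam by rewrite /lam /reg sqrtr_gt0 mulr_gt0.
have lam2 : lam ^+ 2 = c * enorm (gradphi F x).
  by rewrite /lam /reg sqr_sqrtr // mulr_ge0 ?ltW.
have hs : (B^T *m B + lam%:M) *m s = - gradphi F x.
  rewrite /s /GRLM_step (negbTE g0) addrAC subrr add0r mulmxN mulmxA.
  by rewrite mulmxV ?mul1mx ?damped_gram_unit.
have s0 := enorm_ge0 s.
(* lam |s| <= |g| = lam^2 / c *)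
have cs : c * enorm s <= lam.
  rewrite -(ler_pM2l lam0) -expr2 lam2 mulrCA ler_pM2l //.
  exact: damped_step_le hs.
have cs3 : c * enorm s ^+ 3 <= lam * enorm s ^+ 2.
  by rewrite exprS mulrA ler_wpM2r ?sqr_ge0.
split.
- have Jx v := mulmx_enorm_le _ _ v (Jac_le x).
  have Jz v := mulmx_enorm_le _ _ v (Jac_le z).
  have Jxz v := mulmx_enorm_le _ _ v (Jac_lip x z).
  have e0 : 0 <= L2 * enorm (x - z) by rewrite mulr_ge0 ?enorm_ge0.
  have := model_decrease _ _ _ _ hs _ (F x) _ _ erefl L1_ge0 e0 Jx Jz Jxz.
  have := residual_le x (GRLM_step F c z x); rewrite -/s.
  have := ler_wpM2r (exprn_ge0 3 s0) Mc.
  rewrite -/D; lra.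
- by rewrite /D /energy; have := sqr_ge0 (enorm (B *m s)); lra.
- exact: grad_sqr_le_energy lam0 hs _ (fun v => mulmx_enorm_le _ _ v (Jac_le z)).
Qed.

Variables (m : nat) (x0 : 'cV[R]_d) (x : nat -> 'cV[R]_d).
Hypothesis stale_le : 4 * (L1 * L2) * m%:R <= c.
Hypothesis x_GRLM : GRLM F m c x0 x.

Lemma GRLM_epoch_decrease (k : nat) (eps : R) : 0 < eps ->
  (forall j, (j < m)%N -> eps < enorm (gradphi F (x (m * k + j)))) ->
  enorm (F (x (m * k.+1))) ^+ 2 <= enorm (F (x (m * k))) ^+ 2
    - m%:R * (eps ^+ 2 / (L1 ^+ 2 + Num.sqrt (c * eps))) / 2.
Proof.
move=> eps0 big_grad; have [_ xS] := x_GRLM.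
have step j : (j < m)%N ->
    x (m * k + j).+1 = GRLM_step F c (x (m * k)) (x (m * k + j)).
  by move=> jm; rewrite xS snapshot_epoch.
pose s j := x (m * k + j).+1 - x (m * k + j)%N.
have drift j : enorm (x (m * k + j)%N - x (m * k)%N) <= \sum_(i < j) enorm (s i).
  elim: j => [|j IH].
    by rewrite addn0 subrr big_ord0 enorm0.
  rewrite big_ord_recr addnS /=.
  have -> : x (m * k + j).+1 - x (m * k)%N
      = (x (m * k + j)%N - x (m * k)%N) + s j.
    by rewrite /s [RHS]addrC addrA subrK.
  by apply: le_trans (enormD _ _) _; rewrite lerD2r.
pose D j := energy (Jac F (x (m * k))) (reg F c (x (m * k + j))) (s j).
pose a j := enorm (F (x (m * k + j))) ^+ 2.
have := @epoch_decrease R m (L1 * L2) c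
  (eps ^+ 2 / (L1 ^+ 2 + Num.sqrt (c * eps))) a D (fun j => enorm (s j)).
rewrite /a addn0 -mulnSr; apply => //; first by rewrite mulr_ge0.
  by move=> j; exact: enorm_ge0.
move=> j jm; have gj := big_grad j jm.
have gp := lt_trans eps0 gj.
have g0 : gradphi F (x (m * k + j)) != 0.
  by apply: contraTneq gp => ->; rewrite enorm0 ltxx.
have [] := GRLM_step_decrease (x (m * k)) (x (m * k + j)) g0.
rewrite -(step j jm) -/(s j) -/(D j) => h1 h2 h3.
split=> //; first rewrite addnS; first (apply: le_trans h1 _; rewrite lerD2l).
  rewrite ler_wpM2r ?sqr_ge0 // ler_wpM2l ?drift //.
  by rewrite !mulr_ge0.
apply: le_trans (sqr_div_add_sqrt_le _ _ _ _ c_gt0 eps0 (ltW gj)) _.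
rewrite ler_pdivrMr 1?mulrC //.
by rewrite ltr_wpDl ?sqr_ge0 // sqrtr_gt0 mulr_gt0.
Qed.

Lemma GRLM_epochs_decrease (N : nat) (eps : R) : 0 < eps ->
  (forall t, (t < m * N)%N -> eps < enorm (gradphi F (x t))) ->
  enorm (F (x (m * N))) ^+ 2 <= enorm (F x0) ^+ 2
    - N%:R * (m%:R * (eps ^+ 2 / (L1 ^+ 2 + Num.sqrt (c * eps))) / 2).
Proof.
move=> eps0; elim: N => [|N IH] big_grad.
  by rewrite muln0 mul0r subr0; have [-> _] := x_GRLM.
have /IH h : forall t, (t < m * N)%N -> eps < enorm (gradphi F (x t)).
  move=> t tN; apply: big_grad; rewrite (leq_trans tN) //.
  by rewrite leq_mul2l leqnSn orbT.
have := GRLM_epoch_decrease N eps eps0; rewrite -natr1.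
have big j : (j < m)%N -> eps < enorm (gradphi F (x (m * N + j))).
  by move=> jm; apply: big_grad; rewrite mulnSr ltn_add2l.
by move: h => + /(_ big); set q := (m%:R * _ / 2); lra.
Qed.

End Method.

(** * Flop count *)

(** After [N] full periods the ceiling in the cost is exact. *)
Lemma flops_periods {R : realType} (C0 : R) (d m N : nat) : (0 < m)%N ->
  flops C0 d m (m * N) =
    C0 * (d%:R ^+ 3 * N%:R + d%:R ^+ 2 * (m%:R * N%:R)).
Proof.
move=> m0; rewrite /flops natrM [X in Num.ceil (X / _)]mulrC mulfK ?pnatr_eq0 -?lt0n //.
by rewrite [X in Num.ceil X]pmulrn intrKceil.
Qed.

Theorem corollary11 (R : realType) (c1 c2 L1 L2 M normF0 C0 : R)
    (hc1 : 0 < c1) (hc12 : c1 <= c2) (hL1 : 0 <= L1) (hL2 : 0 <= L2)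
    (hM : 0 < M) (hC0 : 0 < C0) :
  exists2 C : R, 0 < C &
    forall (d : nat) (F : 'cV[R]_d -> 'cV[R]_d) (x0 : 'cV[R]_d),
      (forall x, differentiable F x) ->
      (forall x, snorm (Jac F x) <= L1) ->
      (forall x y, snorm (Jac F x - Jac F y) <= L2 * enorm (x - y)) ->
      (forall x y, enorm (F y) ^+ 2 <=
         enorm (F x + Jac F x *m (y - x)) ^+ 2 + M * enorm (y - x) ^+ 3) ->
      enorm (F x0) = normF0 ->
    forall (eps : R) (m : nat), 0 < eps -> (1 <= m)%N ->
      c1 * eps^-1 <= m%:R -> m%:R <= c2 * eps^-1 ->
    forall x : nat -> 'cV[R]_d,
      GRLM F m (Num.max (4 * L1 * L2 * m%:R) M) x0 x ->
      exists T : nat, [/\ (1 <= T)%N,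
        \big[Num.min/enorm (gradphi F (x 0%N))]_(0 <= t < T)
          enorm (gradphi F (x t)) <= eps &
        flops C0 d m T <= C * (d%:R ^+ 3 * eps^-1 + d%:R ^+ 2 * eps^-2)].
Proof.
have c2_gt0 := lt_le_trans hc1 hc12.
(* K bounds c eps, and A the factor L1^2 + sqrt (c eps); here m eps <= c2 and,
   as m >= 1, also eps <= c2 *)
pose K := Num.max (4 * L1 * L2) M * c2.
have K_gt0 : 0 < K by rewrite mulr_gt0 // lt_max hM orbT.
pose A := L1 ^+ 2 + Num.sqrt K.
have A_gt0 : 0 < A by rewrite ltr_wpDl ?sqr_ge0 // sqrtr_gt0.
(* K1 / eps bounds the number of periods; the summand c2 is for the rounding,
   as 1 <= m <= c2 / eps *)
pose K1 := 2 * A * normF0 ^+ 2 / c1 + c2.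
have K1_gt0 : 0 < K1.
  rewrite ltr_wpDl // divr_ge0 ?(ltW hc1) // mulr_ge0 ?sqr_ge0 //.
  by rewrite mulr_ge0 // ltW.
exists (C0 * (K1 + c2 * K1)); first by rewrite mulr_gt0 // addr_gt0 // mulr_gt0.
move=> d F x0 _ Jac_le Jac_lip residual_le F0 eps m eps0 m0 c1m c2m x xP.
set c := Num.max _ _ in xP.
have c_gt0 : 0 < c by rewrite lt_max hM orbT.
have ei0 : 0 < eps^-1 by rewrite invr_gt0.
have m_ge1 : 1 <= m%:R :> R by rewrite ler1n.
have m_gt0 : 0 < m%:R :> R by rewrite ltr0n.
have me : m%:R * eps <= c2 by rewrite -ler_pdivlMr.
have ce : c * eps <= K.
  have -> : c * eps <= K = (c <= K / eps) by rewrite ler_pdivlMr.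
  have Kl u : u <= Num.max (4 * L1 * L2) M -> u * m%:R <= K / eps.
    move=> uK; apply: (@le_trans _ _ (Num.max (4 * L1 * L2) M * m%:R)).
      by rewrite ler_wpM2r // ltW.
    by rewrite /K -[leRHS]mulrA ler_wpM2l // le_max (ltW hM) orbT.
  rewrite ge_max Kl ?le_max ?lexx //=.
  by apply: le_trans (Kl M _); rewrite ?le_max ?lexx ?orbT // ler_peMr // ltW.
(* delta is the decrease over one period, delta' a bound for it in terms of
   the given constants *)
pose delta := m%:R * (eps ^+ 2 / (L1 ^+ 2 + Num.sqrt (c * eps))) / 2.
pose delta' := c1 * eps / (2 * A).
have delta'_gt0 : 0 < delta' by rewrite divr_gt0 ?mulr_gt0.
have delta'_le : delta' <= delta.
  have den : 0 < L1 ^+ 2 + Num.sqrt (c * eps).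
    by rewrite ltr_wpDl ?sqr_ge0 // sqrtr_gt0 mulr_gt0.
  have h : c1 * eps <= m%:R * eps ^+ 2.
    by rewrite expr2 mulrA ler_wpM2r ?(ltW eps0) // -ler_pdivrMr.
  have -> : delta' = c1 * eps / A / 2 by rewrite /delta' invfM; ring.
  rewrite /delta ler_wpM2r ?invr_ge0 // mulrA; apply: ler_pM => //.
  - by rewrite mulr_ge0 ?ltW.
  - by rewrite invr_ge0 ltW.
  - by rewrite lef_pV2 ?posrE // lerD2l ler_wsqrtr.
pose N := (Num.truncn (normF0 ^+ 2 / delta')).+1.
have N_gt : normF0 ^+ 2 < N%:R * delta' by rewrite -ltr_pdivrMr // truncnS_gt.
have N_le : N%:R <= K1 * eps^-1.
  rewrite /N -natr1 /K1 mulrDl; apply: lerD.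
    apply: (@le_trans _ _ (normF0 ^+ 2 / delta')).
      by rewrite truncn_le divr_ge0 ?sqr_ge0 // ltW.
    by rewrite /delta' !invfM !invrK le_eqVlt; apply/orP; left; apply/eqP; ring.
  exact: le_trans m_ge1 c2m.
exists (m * N)%N; split; first by rewrite muln_gt0 m0.
  have [[t tN ht]|all_big] := pselect (exists2 t, (t < m * N)%N &
      enorm (gradphi F (x t)) <= eps).
    by apply: (@bigmin_inf_seq _ _ _ _ _ t) ht; rewrite ?mem_index_iota.
  have big t : (t < m * N)%N -> eps < enorm (gradphi F (x t)).
    by move=> tN; rewrite ltNge; apply/negP => ht; apply: all_big; exists t.
  have Mc : M <= c by rewrite le_max lexx orbT.
  have kc : 4 * (L1 * L2) * m%:R <= c by rewrite mulrA le_max lexx.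
  have := GRLM_epochs_decrease F L1 L2 M c hL1 hL2 c_gt0 Mc Jac_le Jac_lip
    residual_le m x0 x kc xP N eps eps0 big.
  rewrite F0 -/delta; have := sqr_ge0 (enorm (F (x (m * N)%N))).
  have : N%:R * delta' <= N%:R * delta by rewrite ler_wpM2l.
  by move: N_gt; lra.
rewrite flops_periods // -mulrA ler_wpM2l ?(ltW hC0) //.
have d3 : 0 <= d%:R ^+ 3 :> R by rewrite exprn_ge0.
have d2 : 0 <= d%:R ^+ 2 :> R by rewrite exprn_ge0.
have h3 := ler_wpM2l d3 N_le.
have h2 : d%:R ^+ 2 * (m%:R * N%:R) <= d%:R ^+ 2 * (c2 * K1 * eps^-2).
  rewrite ler_wpM2l //.
  have -> : c2 * K1 * eps^-2 = (c2 * eps^-1) * (K1 * eps^-1).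
    by rewrite -exprVn expr2; ring.
  by apply: ler_pM.
have h5 : 0 <= d%:R ^+ 2 * (K1 * eps^-2).
  by rewrite !mulr_ge0 // ?(ltW K1_gt0) // -exprVn sqr_ge0.
have h6 : 0 <= d%:R ^+ 3 * (c2 * K1 * eps^-1).
  by rewrite !mulr_ge0 // ltW.
lra.
Qed.
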